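(* Let $n\ge 1$ be an odd integer, let $j\ge 1$ be an integer, and let $\nabla_j^{(n)}(z)\in \mathbb{F}_2[z]$ denote the Conway polynomial, reduced modulo $2$, of the generalized Fibonacci link $\mathcal{F}_j^{(n)}=\mathcal{C}(\underbrace{n,n,\ldots,n}_{j})$. Then $$\nabla_j^{(n)}(z)\equiv f_N(z) \pmod 2,$$ where $f_N$ is the $N$-th Fibonacci polynomial and $$N=\left\lfloor \tfrac{j+2}{3}\right\rfloor (n-2)+j+1 \quad\text{if } n\equiv 1 \pmod 4,$$ $$N=\left\lfloor \tfrac{j+2}{3}\right\rfloor (n+2)-(j+1) \quad\text{if } n\equiv 3 \pmod 4.$$
   Context: Fibonacci polynomials: $f_0(z)=0$, $f_1(z)=1$, $f_{m+1}(z)=z f_m(z)+f_{m-1}(z)$. Continued fractions: $[a_1,\ldots,a_m]=a_1+\cfrac{1}{a_2+\cfrac{1}{\cdots+\cfrac{1}{a_m}}}$. Rational links: $\mathcal{C}(a_1,\ldots,a_m)$ denotes the rational (two-bridge) link with Conway normal form $(a_1,\ldots,a_m)$: its standard diagram consists of $m$ consecutive twist regions, the $i$-th having $|a_i|$ crossings, where for odd $i$ right twists count as positive and for even $i$ right twists count as negative (so that the diagram is alternating when all $a_i$ have the same sign). Its Schubert fraction is $\frac{\alpha}{\beta}=[a_1,\ldots,a_m]$ with $\alpha,\beta$ coprime. Two rational links with fractions $\alpha/\beta$, $\alpha'/\beta'$ ($\alpha,\alpha'>0$) are equivalent if and only if $\alpha=\alpha'$ and $\beta'\equiv\beta^{\pm1}\pmod{\alpha}$.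 The link is a knot if $\alpha$ is odd and has two components if $\alpha$ is even. Orientation convention (needed only for two-component links, since the Conway polynomial depends on orientation): a link presented with all even entries as $\mathcal{C}(2a_1,\ldots,2a_m)$ is oriented so that the two strands in each twist region are antiparallel. When $\mathcal{F}_j^{(n)}$ has two components (here $n$ odd, $j\equiv 2\pmod 3$), it is oriented in this way using the expansion of its own fraction $[n,\ldots,n]$ (with $j$ entries) as a continued fraction with nonzero even entries. The Conway polynomial is normalized by $\nabla=1$ for the unknot and the skein relation $\nabla_{L_+}-\nabla_{L_-}=z\nabla_{L_0}$ (signs are irrelevant modulo 2). *)

(* Defs.v *)
(* Mathematical Components (no analysis). *)
From HB Require Import structures.
From mathcomp Require Import all_boot all_order all_algebra.
From Stdlib Require Import Relation_Operators.
Set Implicit Arguments.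
Unset Strict Implicit.
Unset Printing Implicit Defensive.
Import Order.TTheory GRing.Theory Num.Theory.
Local Open Scope ring_scope.

(** * Oriented link diagrams

   A diagram in general position with respect to a height function (here:
   read from left to right) is the list of its elementary events.  Between two
   consecutive events it is a stack of horizontal strands, numbered from 0;
   each strand is directed rightwards ([true]) or leftwards ([false]).

   - [Cup b] creates two adjacent strands, the first directed by [b], the
     second by [~~ b];
   - [Cap] joins two adjacent strands of opposite directions;
   - [Cross s] is a crossing of two adjacent strands, a half-twist that is
     right-handed if [s] and left-handed otherwise.  Handedness does not depend
     on the directions; a crossing of two strands of the same direction is
     positive iff it is right-handed, and a crossing of two strands of opposite
     directions is positive iff it is left-handed.

   An event is paired with the number of the first strand it involves. *)

Variant event := Cup of bool | Cap | Cross of bool.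

Definition slice : Type := (event * nat)%type.
Definition diagram : Type := seq slice.

Definition arity_in (e : event) : nat := if e is Cup _ then 0 else 2.
Definition arity_out (e : event) : nat := if e is Cap then 0 else 2.

(* Directions of the strands to the right of a slice, from those to its left;
   [None] if the slice cannot be placed there. *)
Definition step (c : slice) (st : seq bool) : option (seq bool) :=
  let: (e, i) := c in
  match e, drop i st with
  | Cup b, t => if (i <= size st)%N then Some (take i st ++ [:: b, ~~ b & t])
                else None
  | Cap, [:: x, y & t] => if x != y then Some (take i st ++ t) else None
  | Cross _, [:: x, y & t] => Some (take i st ++ [:: y, x & t])
  | _, _ => None
  end.

Fixpoint run (st : seq bool) (D : diagram) : option (seq bool) :=
  if D is c :: D' then obind (run^~ D') (step c st) else Some st.

Definition is_link (D : diagram) : bool := run [::] D == Some [::].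

(** * Isotopy: the Reidemeister moves for diagrams with a height function *)

Variant local_move : diagram -> diagram -> Prop :=
  (* planar isotopy: distant events commute *)
  | Move_far e1 e2 i d :
      local_move [:: (e1, i); (e2, i + arity_out e1 + d)%N]
                 [:: (e2, i + arity_in e1 + d)%N; (e1, i)]
  (* planar isotopy: straightening a strand *)
  | Move_snake_l b i : local_move [:: (Cup b, i); (Cap, i.+1)] [::]
  | Move_snake_r b i : local_move [:: (Cup b, i.+1); (Cap, i)] [::]
  (* a strand passing in front of, or behind, a turning point; the crossing
     moves to the other leg and its handedness changes *)
  | Move_slide_cup b s i :
      local_move [:: (Cup b, i); (Cross s, i.+1)]
                 [:: (Cup b, i.+1); (Cross (~~ s), i)]
  | Move_slide_cap s i :
      local_move [:: (Cross s, i); (Cap, i.+1)]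
                 [:: (Cross (~~ s), i.+1); (Cap, i)]
  (* Reidemeister I *)
  | Move_R1_cup b s i : local_move [:: (Cup b, i); (Cross s, i)] [:: (Cup (~~ b), i)]
  | Move_R1_cap s i : local_move [:: (Cross s, i); (Cap, i)] [:: (Cap, i)]
  (* Reidemeister II *)
  | Move_R2 s i : local_move [:: (Cross s, i); (Cross (~~ s), i)] [::]
  (* Reidemeister III; the variants with crossings of both kinds follow from
     this one and Reidemeister II *)
  | Move_R3 s i :
      local_move [:: (Cross s, i); (Cross s, i.+1); (Cross s, i)]
                 [:: (Cross s, i.+1); (Cross s, i); (Cross s, i.+1)].

Variant move : diagram -> diagram -> Prop :=
  Move u l r v of local_move l r & is_link (u ++ l ++ v) & is_link (u ++ r ++ v) :
    move (u ++ l ++ v) (u ++ r ++ v).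

Definition isotopic : diagram -> diagram -> Prop := clos_refl_sym_trans diagram move.

(** * The Conway polynomial *)

(* [skein_triple Dpos Dneg Dzero]; strands [i] and [i.+1] enter the crossing with
   directions [x] and [y]. *)
Variant skein_triple : diagram -> diagram -> diagram -> Prop :=
  | Skein_parallel u v i p x q of run [::] u = Some (p ++ [:: x, x & q])
      & size p = i & is_link (u ++ (Cross true, i) :: v) :
      skein_triple (u ++ (Cross true, i) :: v) (u ++ (Cross false, i) :: v)
                   (u ++ v)
  | Skein_antiparallel u v i p x q of run [::] u = Some (p ++ [:: x, ~~ x & q])
      & size p = i & is_link (u ++ (Cross true, i) :: v) :
      skein_triple (u ++ (Cross false, i) :: v) (u ++ (Cross true, i) :: v)
                   (u ++ [:: (Cap, i), (Cup (~~ x), i) & v]).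

(* The classical theorem that such an invariant exists (and is unique on
   nonempty links) is not needed: statements quantify over [nabla]. *)
Record is_conway_polynomial (nabla : diagram -> {poly int}) : Prop := {
  conway_isotopy D D' : isotopic D D' -> nabla D = nabla D';
  conway_unknot : nabla [:: (Cup true, 0%N); (Cap, 0%N)] = 1;
  conway_skein Dp Dm D0 :
    skein_triple Dp Dm D0 -> nabla Dp - nabla Dm = 'X * nabla D0
}.

(** * Rational links *)

(* The twist region number [k], counted from 0: a horizontal twist on strands
   1, 2 if [k] is even, on strands 0, 1 if [k] is odd.  Right twists are
   positive for [k] even, negative for [k] odd. *)
Definition twist_region (k : nat) (a : int) : diagram :=
  nseq `|a|%N (Cross ((0 < a) (+) odd k), if odd k then 0%N else 1%N).

Fixpoint twist_regions (k : nat) (a : seq int) : diagram :=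
  if a is x :: a' then twist_region k x ++ twist_regions k.+1 a' else [::].

(* The standard diagram of Conway's normal form C(a_1, ..., a_m).  On the left,
   strands 0, 1 and strands 2, 3 are joined.  On the right, strands 0, 1 and
   strands 2, 3 are joined if m is odd, strands 1, 2 and strands 0, 3 if m is
   even.  Every component goes through one of the two arcs on the left, so an
   orientation amounts to directions [b1], [b2] of these for which the result
   satisfies [is_link]. *)
Definition conway_diagram (b1 b2 : bool) (a : seq int) : diagram :=
  [:: (Cup b1, 0%N); (Cup b2, 2)] ++ twist_regions 0 a
  ++ [:: (Cap, if odd (size a) then 0%N else 1%N); (Cap, 0%N)].

Definition conway_normal_form (a : seq int) (D : diagram) : Prop :=
  is_link D /\ exists b1 b2, D = conway_diagram b1 b2 a.

(* The value of [a_1, ..., a_m]; since 0^-1 = 0 in [rat], [cfrac [:: x]] is [x]. *)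
Fixpoint cfrac (a : seq int) : rat :=
  if a is x :: a' then x%:~R + (cfrac a')^-1 else 0.

Fixpoint antiparallel_from (st : seq bool) (D : diagram) : bool :=
  if D is c :: D' then
    (if c is (Cross _, i) then nth true st i != nth true st i.+1 else true)
    && (if step c st is Some st' then antiparallel_from st' D' else false)
  else true.

(* At each crossing the two strands have opposite directions. *)
Definition antiparallel (D : diagram) : bool := antiparallel_from [::] D.

(* [D] is oriented as C(2 b_1, ..., 2 b_m) with antiparallel twist regions, for
   the expansion [2 b_1, ..., 2 b_m] of the fraction [a_1, ..., a_m]. *)
Definition even_orientation (a : seq int) (D : diagram) : Prop :=
  exists b : seq int,
    [/\ all (fun x => x != 0) b,
        cfrac [seq 2 * x | x <- b] = cfrac a
      & exists D', [/\ conway_normal_form [seq 2 * x | x <- b] D',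
                       antiparallel D' & isotopic D D']].

(* [D] is the oriented link C(n, ..., n) with [j] entries, [n] odd: it is a knot,
   with any orientation, unless [j = 2 %[mod 3]], when it has two components. *)
Definition fibonacci_link (n j : nat) (D : diagram) : Prop :=
  conway_normal_form (nseq j n%:Z) D
  /\ (j = 2 %[mod 3] -> even_orientation (nseq j n%:Z) D).

(** * Fibonacci polynomials *)

Fixpoint fib_poly (m : nat) : {poly int} :=
  match m with
  | 0 => 0
  | 1 => 1
  | (m'.+1 as m1).+1 => 'X * fib_poly m1 + fib_poly m'
  end.

Definition poly_mod2 (p : {poly int}) : {poly 'F_2} :=
  map_poly (intr : int -> 'F_2) p.

(* Main.v *)
Require Import Defs.
From mathcomp Require Import all_boot all_order all_algebra.
From mathcomp Require Import ring lra zify.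
From Stdlib Require Import Relation_Operators.
Set Implicit Arguments.
Unset Strict Implicit.
Unset Printing Implicit Defensive.
Import Order.TTheory GRing.Theory Num.Theory.
Local Open Scope ring_scope.

(* Cut a two-bridge diagram after some twist regions.  Modulo 2, the Conway
   polynomial of the whole depends on the left part only through a vector of
   rank two: the skein relation writes it as a combination of the two
   crossingless tangles (when the four strands alternate in direction), and the
   closure of one of these is an unknot, of the other an unlink.

   For C(n, ..., n) with n = 2k + 1, three consecutive regions preserve the
   alternating pattern: the outer two twist antiparallel strands and add a
   multiple of z k or z (k + 1), the middle one twists parallel strands and brings
   in f_n.  Modulo 2 the product of the three is the p-th power of the Fibonacci
   matrix [z 1; 1 0], with p = n + 1 if k is even and, up to exchanging the two
   tangles, p = n - 1 if k is odd.  This settles the knots; when j = 1 mod 3, an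
   extra region is first inserted at each end, where it is only a sequence of
   kinks.

   When j = 2 mod 3 the orientation is that of the expansion with even entries
     [n, n, n, u] = [n+1, -2, 2, ..., -2, 2, -(n+1), -u],
   which is unique, and an antiparallel region with 2x crossings acts by
   [xz 1; 1 0]. *)

Lemma oppr_poly2 (p : {poly 'F_2}) : - p = p.
Proof. by apply/polyP=> i; rewrite coefN oppr_pchar2 ?pchar_Fp. Qed.

Lemma addrr_poly2 (p : {poly 'F_2}) : p + p = 0.
Proof. by rewrite -{2}[p]oppr_poly2 subrr. Qed.

(** * Directions of the strands through twist regions *)

Lemma run_cons st c D : run st (c :: D) = obind (run^~ D) (step c st).
Proof. by []. Qed.

Lemma run_cat st D1 D2 : run st (D1 ++ D2) = obind (run^~ D2) (run st D1).
Proof. by elim: D1 st => //= c D1 IH st; case: (step c st) => //=. Qed.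

Local Arguments step : simpl never.
Local Arguments run : simpl never.

Lemma step_cup b p r :
  step (Cup b, size p) (p ++ r) = Some (p ++ [:: b, ~~ b & r]).
Proof. by rewrite /step size_cat leq_addr take_size_cat // drop_size_cat. Qed.

Lemma step_cap p x r : step (Cap, size p) (p ++ [:: x, ~~ x & r]) = Some (p ++ r).
Proof. by rewrite /step drop_size_cat // take_size_cat //; case: x. Qed.

Lemma step_cross s p x y r :
  step (Cross s, size p) (p ++ [:: x, y & r]) = Some (p ++ [:: y, x & r]).
Proof. by rewrite /step drop_size_cat // take_size_cat. Qed.

Definition twists (i : nat) (s : bool) (m : nat) : diagram := nseq m (Cross s, i).

Lemma twistsS i s m : twists i s m.+1 = (Cross s, i) :: twists i s m.
Proof. by []. Qed.

Lemma twistsD i s m m' : twists i s (m + m') = twists i s m ++ twists i s m'.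
Proof. by rewrite /twists nseqD. Qed.

Lemma run_tw s m p x y r :
  run (p ++ [:: x, y & r]) (twists (size p) s m) =
    Some (p ++ (if odd m then [:: y, x & r] else [:: x, y & r])).
Proof.
elim: m x y => // m IH x y.
by rewrite twistsS run_cons step_cross /= IH; case: (odd m).
Qed.

(* A boolean [q] stands for the position, 0 or 1, of a twist region, hence for
   [~~ odd k] in region [k].  The tangle joins strands 0, 1 and 2, 3 if
   [q = false], strands 0, 3 and 1, 2 if [q = true]. *)
Definition tangle (q b c : bool) : diagram := [:: (Cup b, 0%N); (Cup c, q : nat)].

(* Directions [b; ~~ b; b; ~~ b], whatever [q]. *)
Definition alt (q b : bool) : diagram := tangle q b (q (+) b).

(* The strands at position [~~ q] are parallel. *)
Definition par (q b : bool) : diagram := tangle q b (~~ (q (+) b)).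

Lemma run_tangle q b c :
  run [::] (tangle q b c) =
    Some (if q then [:: b; c; ~~ c; ~~ b] else [:: c; ~~ c; b; ~~ b]).
Proof. by case: q. Qed.

Lemma run_alt q b : run [::] (alt q b) = Some [:: b; ~~ b; b; ~~ b].
Proof. by rewrite run_tangle; case: q b => [] []. Qed.

Lemma run_par q b :
  run [::] (par q b) =
    Some (if q then [:: b; b; ~~ b; ~~ b] else [:: ~~ b; b; b; ~~ b]).
Proof. by rewrite run_tangle; case: q b => [] []. Qed.

Local Arguments alt : simpl never.
Local Arguments par : simpl never.
Local Arguments twists : simpl never.

Lemma run_par_tw (q b s : bool) m :
  run [::] (par q b ++ twists (~~ q) s m) = run [::] (par q b).
Proof.
rewrite run_cat run_par /=; case: q.
  by rewrite (run_tw s m [::]) if_same.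
by rewrite (run_tw s m [:: ~~ b]) if_same.
Qed.

Lemma run_par_tw_same (q q' b s : bool) m :
  odd m -> run [::] (par q b ++ twists q s m) = run [::] (alt q' b).
Proof.
move=> m_odd; rewrite run_cat run_par run_alt /=; case: q.
  by rewrite (run_tw s m [:: b]) m_odd.
by rewrite (run_tw s m [::]) m_odd.
Qed.

Lemma run_alt_tw (p q b s : bool) m :
  run [::] (alt p b ++ twists q s m) = run [::] (if odd m then par q b else alt q b).
Proof.
rewrite run_cat run_alt /=; case: q.
  by rewrite (run_tw s m [:: b]); case: (odd m); rewrite ?run_par ?run_alt.
by rewrite (run_tw s m [::]); case: (odd m); rewrite ?run_par ?run_alt.
Qed.

Lemma link_prefix u u' v :
  run [::] u = run [::] u' -> is_link (u ++ v) = is_link (u' ++ v).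
Proof. by rewrite /is_link !run_cat => ->. Qed.

(* Positive twist regions are right-handed at position 1, left-handed at
   position 0: their handedness is [q]. *)
Fixpoint blocks (q : bool) (n j : nat) : diagram :=
  if j is j'.+1 then twists q q n ++ blocks (~~ q) n j' else [::].

Lemma blocksD q n j l :
  blocks q n (j + l) = blocks q n j ++ blocks (q (+) odd j) n l.
Proof.
by elim: j q => [|j IH] q; rewrite ?addbF //= IH catA addbN addNb.
Qed.

Lemma blocks_triple q n j :
  blocks q n (3 + j)
  = twists q q n ++ twists (~~ q) (~~ q) n ++ twists q q n ++ blocks (~~ q) n j.
Proof. by rewrite /= !negbK. Qed.

Lemma twist_regions_nseq k n j :
  twist_regions k (nseq j n%:Z) = blocks (~~ odd k) n j.
Proof.
elim: j k => //= j IH k; rewrite IH /=; congr (_ ++ _).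
by case: n {IH} => // n; rewrite /twist_region /twists; case: (odd k).
Qed.

Lemma run_tw0 s n x y r :
  odd n -> run [:: x, y & r] (twists 0 s n) = Some [:: y, x & r].
Proof. by move=> n_odd; rewrite (run_tw s n [::]) n_odd. Qed.

Lemma run_tw1 s n z x y r :
  odd n -> run [:: z, x, y & r] (twists 1 s n) = Some [:: z, y, x & r].
Proof. by move=> n_odd; rewrite (run_tw s n [:: z]) n_odd. Qed.

(** Three odd regions permute the strands by (0 1)(1 2)(0 1) = (1 2)(0 1)(1 2), the transposition of
    strands 0 and 2; hence neither [q] nor more than the parity of [r] matters. *)
Lemma run_triples q n r x0 x1 x2 x3 :
    odd n ->
  run [:: x0; x1; x2; x3] (blocks q n (3 * r))
  = Some (if odd r then [:: x2; x1; x0; x3] else [:: x0; x1; x2; x3]).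
Proof.
move=> n_odd; elim: r q x0 x1 x2 x3 => // r IH q x0 x1 x2 x3.
rewrite mulnS blocksD run_cat /= !run_cat.
by case: q; do 3!rewrite /= ?(run_tw0, run_tw1) //= ?run_cat; rewrite /= IH; case: (odd r).
Qed.

Definition closing (q : bool) : diagram := [:: (Cap, q : nat); (Cap, 0%N)].

Lemma link_alt p q b v : is_link (alt p b ++ v) = is_link (alt q b ++ v).
Proof. by rewrite /is_link !run_cat !run_alt. Qed.

Lemma link_alt_closing p q b : is_link (alt p b ++ closing q).
Proof. by case: p q b => [] [] []. Qed.

Lemma conway_diagram_nseq b1 b2 n j :
  conway_diagram b1 b2 (nseq j n%:Z)
  = [:: (Cup b1, 0%N); (Cup b2, 2)] ++ blocks true n j ++ closing (~~ odd j).
Proof.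
by rewrite /conway_diagram size_nseq twist_regions_nseq /closing; case: (odd j).
Qed.

Lemma link_cups b1 b2 v :
  is_link ([:: (Cup b1, 0%N); (Cup b2, 2)] ++ v)
  = (run [:: b1; ~~ b1; b2; ~~ b2] v == Some [::]).
Proof. by []. Qed.

Lemma link_tangle_cups b1 b2 v :
  is_link (tangle false b2 b1 ++ v) = is_link ([:: (Cup b1, 0%N); (Cup b2, 2)] ++ v).
Proof. by []. Qed.

(* [ring] does not know that 2 = 0 here; the witness [t] is what cancels. *)
Lemma eq_poly2 (x y t : {poly 'F_2}) : x = y + t *+ 2 -> x = y.
Proof. by move=> ->; rewrite mulr2n addrr_poly2 addr0. Qed.

Lemma natr_poly2 k : k%:R = (odd k)%:R :> {poly 'F_2}.
Proof.
apply: (eq_poly2 (t := (k./2)%:R)).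
by rewrite -[in LHS](odd_double_half k) natrD -muln2 natrM mulr_natr.
Qed.

(** * Fibonacci polynomials over the field with two elements *)

Definition fib2 (m : nat) : {poly 'F_2} := poly_mod2 (fib_poly m).

Lemma fib2_0 : fib2 0 = 0.
Proof. exact: rmorph0. Qed.

Lemma fib2_1 : fib2 1 = 1.
Proof. exact: rmorph1. Qed.

Lemma fib2_SS m : fib2 m.+2 = 'X * fib2 m.+1 + fib2 m.
Proof. by rewrite /fib2 /poly_mod2 /= rmorphD rmorphM /= map_polyX. Qed.

Lemma fib2_pred m : fib2 m = fib2 m.+2 + 'X * fib2 m.+1.
Proof. by apply/esym/(eq_poly2 (t := 'X * fib2 m.+1)); rewrite fib2_SS; ring. Qed.

Lemma fib2_addS m p :
  fib2 (m + p).+1 = fib2 m.+1 * fib2 p.+1 + fib2 m * fib2 p.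
Proof.
elim: m p => [|m IH] p; first by rewrite add0n fib2_1 fib2_0; ring.
by rewrite addSnnS IH !fib2_SS; ring.
Qed.

(** The last factor is f_(p-1), written so that [p = 0] is covered. *)
Lemma fib2_add m p :
  fib2 (m + p) = fib2 m.+1 * fib2 p + fib2 m * (fib2 p.+1 + 'X * fib2 p).
Proof.
rewrite fib2_pred (fib2_addS m p) -addnS fib2_addS fib2_SS.
by apply: (eq_poly2 (t := 'X * fib2 m.+1 * fib2 p.+1)); ring.
Qed.

(** * Even continued fractions *)

(** The matrix [xz 1; 1 0]: modulo 2 only the parity of [x] survives. *)
Definition continuant_step (x : int) (p : {poly 'F_2} * {poly 'F_2}) :=
  ((odd `|x|)%:R * 'X * p.1 + p.2, p.1).

(* The [m]-th power of the Fibonacci matrix; [fib2 m.+1 + 'X * fib2 m] is f_(m-1),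
   including f_(-1) = 1. *)
Definition fib_act (m : nat) (p : {poly 'F_2} * {poly 'F_2}) :=
  (fib2 m.+1 * p.1 + fib2 m * p.2,
   fib2 m * p.1 + (fib2 m.+1 + 'X * fib2 m) * p.2).

Local Arguments fib_act : simpl never.

Lemma fib_actD m m' p : fib_act m (fib_act m' p) = fib_act (m + m') p.
Proof.
by rewrite /fib_act /= !fib2_addS !fib2_add; congr pair; ring.
Qed.

Lemma continuant_step_odd x p : odd `|x| -> continuant_step x p = fib_act 1 p.
Proof.
move=> x_odd; rewrite /continuant_step x_odd /fib_act fib2_SS fib2_1 fib2_0 /=.
congr pair; first by ring.
by apply: (eq_poly2 (t := - 'X * p.2)); ring.
Qed.

Definition swap (T : Type) (p : T * T) := (p.2, p.1).

Lemma continuant_step_even x p : ~~ odd `|x| -> continuant_step x p = swap p.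
Proof. by move=> /negPf x_even; rewrite /continuant_step x_even !mul0r add0r; case: p. Qed.

Lemma swapK T : involutive (@swap T).
Proof. by case. Qed.

Lemma continuant_opp l p : foldr continuant_step p (map -%R l) = foldr continuant_step p l.
Proof. by elim: l => //= x l ->; rewrite /continuant_step abszN. Qed.

(** Halves of the inner entries -2, 2, ..., -2, 2 of the even expansion. *)
Fixpoint alternating_ones (k : nat) : seq int :=
  if k is k'.+1 then [:: -1, 1 & alternating_ones k'] else [::].

Lemma continuant_alternating_ones k p :
  foldr continuant_step p (alternating_ones k) = fib_act k.*2 p.
Proof.
elim: k => [|k IH] /=.
  by rewrite /fib_act fib2_1 fib2_0; case: p => a c /=; congr pair; ring.
by rewrite IH !continuant_step_odd // !fib_actD.
Qed.

(* Half the entries of the even expansion of [n, ..., n], with [3 * r + 2] entries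
   [n = k.*2.+1]; the half of [n + 1] is [k.+1]. *)
Fixpoint even_exp (k r : nat) : seq int :=
  (k.+1%:Z :: alternating_ones k) ++
  if r is r'.+1 then - k.+1%:Z :: map -%R (even_exp k r') else [::].

(** For [k] even all (r+1)(2k+2) - 1 entries are odd, and each gives one Fibonacci factor. For [k]
    odd the entries k+1 and -(k+1) act as swaps; neighbouring ones cancel, which leaves the swap at
    the head and the 2k units of each block. *)
Lemma continuant_even_exp k r :
  (foldr continuant_step (1, 0) (even_exp k r)).1 = fib2 (r.+1 * (k + ~~ odd k).*2)%N.
Proof.
have [k_odd | k_even] /= := boolP (odd k).
  have -> : foldr continuant_step (1, 0) (even_exp k r) = swap (fib_act (r.+1 * k.*2)%N (1, 0)).
    elim: r => [|r IH].
      rewrite /even_exp cats0 [foldr _ _ _]/= continuant_alternating_ones mul1n.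
      by rewrite continuant_step_even //= negbK.
    rewrite [foldr _ _ _]/= foldr_cat [foldr _ _ (_ :: _)]/= continuant_opp IH.
    rewrite continuant_alternating_ones !continuant_step_even ?abszN ?negbK //.
    by rewrite swapK fib_actD mulSn.
  by rewrite /fib_act /= addn0; ring.
have -> : foldr continuant_step (1, 0) (even_exp k r) = fib_act (r * k.+1.*2 + k.*2.+1)%N (1, 0).
  elim: r => [|r IH].
    by rewrite /even_exp cats0 /= continuant_alternating_ones continuant_step_odd // fib_actD.
  rewrite /= foldr_cat /= continuant_opp IH continuant_alternating_ones.
  rewrite !continuant_step_odd ?abszN // !fib_actD; congr fib_act; lia.
by rewrite /= mulr1 mulr0 addr0; congr fib2; lia.
Qed.

Definition doubled (l : seq int) : seq int := [seq 2 * x | x <- l].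

Lemma cfrac_opp l : cfrac (map -%R l) = - cfrac l.
Proof. by elim: l => [|x l /= ->]; rewrite /= ?oppr0 // rmorphN invrN opprD. Qed.

(** Prefixing -2, 2 only adds 2 to [d]. At [d = 0] the inner fraction is 0 by convention and both
    sides are -3/2. *)
Lemma alternating_ones_step (d : rat) :
  0 <= d -> - 2 + (2 + (- ((1 + d) / d))^-1)^-1 = - ((1 + (2 + d)) / (2 + d)).
Proof.
rewrite le_eqVlt => /predU1P[<- | d_gt0]; first exact/eqP.
by field; apply/and4P; split; try (by apply: lt0r_neq0; lra); apply: ltr0_neq0; lra.
Qed.

(* The case [e = 0] is that of an empty tail [l], as [cfrac [::]] and [1 / 0] are 0. *)
Lemma cfrac_alternating_ones k (e : rat) l :
  0 <= e -> cfrac (doubled l) = - ((1 + e) / e) ->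
  cfrac (doubled (alternating_ones k ++ l)) = - ((1 + (k.*2%:R + e)) / (k.*2%:R + e)).
Proof.
move=> e_ge0 el; elim: k => [|k IH] /=; first by rewrite add0r.
rewrite -/(doubled _) IH alternating_ones_step ?addr_ge0 ?ler0n //.
by congr (- ((1 + _) / _)); rewrite doubleS -addn2 natrD; ring.
Qed.

(** With x = 2k this is x + 2 - (x+e)/(x+1+e) = (x+1) + 1/(x+1+e): one block of even entries stands
    for two entries n. *)
Lemma cfrac_even_exp_head k (e : rat) l :
  0 <= e -> cfrac (doubled l) = - ((1 + e) / e) ->
  cfrac (doubled (k.+1%:Z :: alternating_ones k ++ l))
  = k.*2.+1%:R + (k.*2.+1%:R + e)^-1.
Proof.
move=> e_ge0 el; rewrite /= -/(doubled _) (cfrac_alternating_ones k e_ge0 el).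
have k_ge0 : 0 <= k.*2%:R :> rat by rewrite ler0n.
have -> : (2 * k.+1%:Z)%:~R = k.*2%:R + 2 :> rat.
  by rewrite (_ : 2 * k.+1%:Z = (k.*2 + 2)%N%:Z) -?pmulrn ?natrD //; lia.
rewrite -(natr1 k.*2); move: {k el}(k.*2%:R : rat) k_ge0 => x x_ge0.
(* If x + e = 0, division by zero makes the tail vanish, and both sides are 2. *)
have := addr_ge0 x_ge0 e_ge0; rewrite le_eqVlt => /predU1P[z | d_gt0].
  have -> : x = 0 by lra.
  have -> : e = 0 by lra.
  exact/eqP.
by field; apply/andP; split; apply: lt0r_neq0; lra.
Qed.

Lemma doubled_opp l : doubled (map -%R l) = map -%R (doubled l).
Proof. by rewrite /doubled -!map_comp; apply: eq_map => x /=; rewrite mulrN. Qed.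

Lemma even_exp_neq0 k r : all (fun x => x != 0) (even_exp k r).
Proof.
have ones_neq0 : all (fun x => x != 0) (alternating_ones k) by elim: k.
elim: r => [|r IH] /=; rewrite all_cat ones_neq0 //=.
by rewrite all_map; apply: sub_all IH => x; rewrite /= oppr_eq0.
Qed.

Lemma cfrac_even_exp k r :
  let n := k.*2.+1 in
  0 < cfrac (nseq (3 * r + 2) n%:Z)
  /\ cfrac (doubled (even_exp k r)) = cfrac (nseq (3 * r + 2) n%:Z).
Proof.
move=> n; have n_gt0 : 0 < n%:~R :> rat by rewrite ltr0n.
elim: r => [|r [IH0 IH]].
  rewrite muln0; split; first by rewrite /= invr0 addr0 addr_gt0 ?invr_gt0.
  rewrite /even_exp -[_ ++ _]/(k.+1%:Z :: alternating_ones k ++ [::]) (@cfrac_even_exp_head _ 0) //.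
  by rewrite /= invr0 !addr0.
rewrite mulnS -addnA; move: (3 * r + 2)%N IH0 IH => j u_gt0 IH.
rewrite [cfrac (nseq _ _)]/=; set u := cfrac _ in u_gt0 IH *.
(* With this [e], n + 1/(n+e) is [n, n, n, u], and -(1+e)/e = -(n+1) - 1/u is the value of the
   negated tail. *)
set e := (n%:~R + u^-1)^-1.
have e_gt0 : 0 < e by rewrite invr_gt0 addr_gt0 ?invr_gt0.
split; first by rewrite addr_gt0 ?invr_gt0 // addr_gt0.
rewrite [even_exp _ _]/= (@cfrac_even_exp_head _ e) ?ltW //.
rewrite [LHS]/= -/(doubled _) doubled_opp cfrac_opp IH invrN.
have -> : (2 * - k.+1%:Z)%:~R = - (n%:~R + 1) :> rat.
  by rewrite (_ : 2 * - k.+1%:Z = - (n%:Z + 1)) ?rmorphN ?rmorphD //; lia.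
rewrite mulrDl mul1r divff ?gt_eqF // /e invrK; ring.
Qed.

(** * Uniqueness of the even expansion *)

Lemma even_quotient_gt1 (x : int) (y : rat) :
  x != 0 -> `|y| < 1 -> 1 < `|(2 * x)%:~R + y|.
Proof.
move=> x_neq0 y_lt1.
have : (2%:~R : rat) <= `|(2 * x)%:~R| by rewrite -intr_norm ler_int; lia.
have := lerB_normD ((2 * x)%:~R) y; lra.
Qed.

Lemma cfrac_doubled_inv_lt1 l :
  all (fun x => x != 0) l -> `|(cfrac (doubled l))^-1| < 1.
Proof.
elim: l => [|x l IH] /=; first by rewrite invr0 normr0.
case/andP=> x_neq0 /IH /(even_quotient_gt1 x_neq0) gt1.
by rewrite normfV invf_lt1 // (lt_trans _ gt1).
Qed.

(** Both tails contribute less than 1 in absolute value, so the leading even integers differ by less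
    than 2 and agree. *)
Lemma doubled_cfrac_inj l l' :
    all (fun x => x != 0) l -> all (fun x => x != 0) l' ->
  cfrac (doubled l) = cfrac (doubled l') -> l = l'.
Proof.
elim: l l' => [|x l IH] [|x' l'] //=.
- move=> _ /andP[x_neq0 /cfrac_doubled_inv_lt1 /(even_quotient_gt1 x_neq0)] + e.
  by rewrite -/(doubled _) -e normr0.
- move=> /andP[x_neq0 /cfrac_doubled_inv_lt1 /(even_quotient_gt1 x_neq0)] + _ e.
  by rewrite -/(doubled _) e normr0.
move=> /andP[_ l_neq0] /andP[_ l'_neq0]; rewrite -!/(doubled _) => e.
have y_lt1 := cfrac_doubled_inv_lt1 l_neq0.
have y'_lt1 := cfrac_doubled_inv_lt1 l'_neq0.
have xx' : x = x'.
  have : `|(2 * x - 2 * x')%:~R| < 2%:~R :> rat.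
    rewrite rmorphB /=; move: y_lt1 y'_lt1; rewrite !ltr_norml; lra.
  by rewrite -intr_norm ltr_int; lia.
by move: e; rewrite -xx' => /addrI /invr_inj /IH ->.
Qed.

Lemma twist_region_doubled k x :
  twist_region k (2 * x) = twists (~~ odd k) ((0 < 2 * x) (+) odd k) `|x|.*2.
Proof.
rewrite /twist_region /twists abszM mul2n.
by case: (odd k).
Qed.

Lemma run_alt_doubled p q b k l :
  run [::] (alt p b ++ twist_regions k (doubled l)) = run [::] (alt q b).
Proof.
elim: l k p => [|x l IH] k p; first by rewrite cats0 !run_alt.
rewrite [twist_regions _ _]/= twist_region_doubled catA -(IH k.+1 (~~ odd k)) !run_cat.
have := run_alt_tw p (~~ odd k) b ((0 < 2 * x) (+) odd k) `|x|.*2.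
by rewrite odd_double run_cat => ->.
Qed.

(** * Conway polynomials modulo 2 *)

Section Skein.
Context (nabla : diagram -> {poly int}) (nablaP : is_conway_polynomial nabla).
Local Notation nu D := (poly_mod2 (nabla D)).

Lemma nu_local u l r v st :
  local_move l r -> run [::] u = Some st -> run st l = run st r ->
  is_link (u ++ r ++ v) -> nu (u ++ l ++ v) = nu (u ++ r ++ v).
Proof.
move=> lr ru e link_r; congr poly_mod2; apply: (conway_isotopy nablaP).
by apply: rst_step; split=> //; move: link_r; rewrite /is_link !run_cat ru /= !run_cat e.
Qed.

Lemma nu_skein Dp Dm D0 :
  skein_triple Dp Dm D0 -> nu Dp = nu Dm + 'X * nu D0.
Proof.
move=> /(conway_skein nablaP) /(congr1 poly_mod2).
rewrite /poly_mod2 rmorphB rmorphM /= map_polyX => <-; ring.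
Qed.

Lemma nu_skein_sym Dp Dm D0 :
  skein_triple Dp Dm D0 -> nu Dm = nu Dp + 'X * nu D0.
Proof.
by move/nu_skein=> ->; rewrite -addrA addrr_poly2 addr0.
Qed.

(** Modulo 2 the skein relation is symmetric in the two crossings, so [s] is arbitrary. *)
Lemma nu_parallel s u v p x r :
    run [::] u = Some (p ++ [:: x, x & r]) ->
    run (p ++ [:: x, x & r]) v = Some [::] ->
  nu (u ++ (Cross s, size p) :: v)
  = nu (u ++ (Cross (~~ s), size p) :: v) + 'X * nu (u ++ v).
Proof.
move=> ru rv.
have T : skein_triple (u ++ (Cross true, size p) :: v)
    (u ++ (Cross false, size p) :: v) (u ++ v).
  by apply: (Skein_parallel ru); rewrite // /is_link run_cat ru /= run_cons step_cross /= rv.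
by case: s; [exact: nu_skein T | exact: nu_skein_sym T].
Qed.

Lemma nu_antiparallel s u v p x r :
    run [::] u = Some (p ++ [:: x, ~~ x & r]) ->
    run (p ++ [:: ~~ x, x & r]) v = Some [::] ->
  nu (u ++ (Cross s, size p) :: v)
  = nu (u ++ (Cross (~~ s), size p) :: v)
    + 'X * nu (u ++ [:: (Cap, size p), (Cup (~~ x), size p) & v]).
Proof.
move=> ru rv.
have T : skein_triple (u ++ (Cross false, size p) :: v)
    (u ++ (Cross true, size p) :: v)
    (u ++ [:: (Cap, size p), (Cup (~~ x), size p) & v]).
  by apply: (Skein_antiparallel ru); rewrite // /is_link run_cat ru /= run_cons step_cross /= rv.
by case: s; [exact: nu_skein_sym T | exact: nu_skein T].
Qed.

Lemma nu_R2 s u v p x y r :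
    run [::] u = Some (p ++ [:: x, y & r]) ->
    run (p ++ [:: x, y & r]) v = Some [::] ->
  nu (u ++ [:: (Cross s, size p), (Cross (~~ s), size p) & v]) = nu (u ++ v).
Proof.
move=> ru rv; apply: (nu_local (Move_R2 s (size p)) ru).
  by rewrite run_cons step_cross /= run_cons step_cross.
by rewrite /is_link run_cat ru /= rv.
Qed.

Lemma nu_R1_cup b s m u v p r :
    run [::] u = Some (p ++ r) ->
    is_link (u ++ (Cup (b (+) odd m), size p) :: v) ->
  nu (u ++ (Cup b, size p) :: twists (size p) s m ++ v)
  = nu (u ++ (Cup (b (+) odd m), size p) :: v).
Proof.
move=> ru; elim: m b => [|m IH] b; first by rewrite addbF.
rewrite twistsS /= addbN -addNb => link; rewrite -IH //.
apply: (nu_local (Move_R1_cup b s (size p)) ru).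
  by rewrite !run_cons !step_cup /= run_cons step_cross negbK.
move: link; rewrite /is_link !run_cat ru /= !run_cons !step_cup /= run_cat run_tw.
by case: b (odd m) => [] [].
Qed.

Lemma nu_R1_cap s m u v p x r :
    run [::] u = Some (p ++ [:: x, ~~ x & r]) -> run (p ++ r) v = Some [::] ->
  nu (u ++ twists (size p) s m ++ (Cap, size p) :: v)
  = nu (u ++ (Cap, size p) :: v).
Proof.
move=> ru rv; elim: m => // m IH; rewrite -IH -(addn1 m) twistsD -!catA.
have rt := run_tw s m p x (~~ x) r.
have [y ry] : exists y, run [::] (u ++ twists (size p) s m) = Some (p ++ [:: y, ~~ y & r]).
  rewrite run_cat ru /= rt; case: (odd m); last by exists x.
  by exists (~~ x); rewrite negbK.
have e : run (p ++ [:: y, ~~ y & r]) [:: (Cross s, size p); (Cap, size p)]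
    = run (p ++ [:: y, ~~ y & r]) [:: (Cap, size p)].
  by rewrite !run_cons step_cross step_cap /= run_cons -{2}[y]negbK step_cap.
have := @nu_local _ _ _ v _ (Move_R1_cap s (size p)) ry e.
rewrite -!catA => ->//.
by rewrite /is_link catA run_cat ry /= run_cons step_cap /= rv.
Qed.

(** Apply the skein relation to the first crossing: switched, it cancels the second; smoothed, it
    disappears. *)
Lemma nu_tw_parallel s m u v p x r :
    run [::] u = Some (p ++ [:: x, x & r]) ->
    run (p ++ [:: x, x & r]) v = Some [::] ->
  nu (u ++ twists (size p) s m.+2 ++ v)
  = nu (u ++ twists (size p) s m ++ v) + 'X * nu (u ++ twists (size p) s m.+1 ++ v).
Proof.
move=> ru rv; rewrite [in LHS]twistsS.
have rt k : run (p ++ [:: x, x & r]) (twists (size p) s k ++ v) = Some [::].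
  by rewrite run_cat run_tw if_same.
rewrite cat_cons (nu_parallel s ru (rt m.+1)); congr (_ + _).
by rewrite -[in RHS](nu_R2 (~~ s) ru (rt m)) negbK.
Qed.

(** Here smoothing the first crossing turns the other [m.+1] into kinks on a new cup, each reversing
    its direction. *)
Lemma nu_tw_antiparallel s m u v p x r :
    run [::] u = Some (p ++ [:: x, ~~ x & r]) ->
    run (p ++ if odd m then [:: ~~ x, x & r] else [:: x, ~~ x & r]) v = Some [::] ->
  nu (u ++ twists (size p) s m.+2 ++ v)
  = nu (u ++ twists (size p) s m ++ v)
    + 'X * nu (u ++ [:: (Cap, size p), (Cup (x (+) odd m), size p) & v]).
Proof.
move=> ru rv; rewrite [in LHS]twistsS.
have rt : run (p ++ [:: x, ~~ x & r]) (twists (size p) s m ++ v) = Some [::].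
  by rewrite run_cat run_tw.
have rt' : run (p ++ [:: ~~ x, x & r]) (twists (size p) s m.+1 ++ v) = Some [::].
  by rewrite run_cat run_tw; move: rv => /=; case: (odd m).
rewrite cat_cons (nu_antiparallel s ru rt'); congr (_ + _ * _).
  by rewrite -[in RHS](nu_R2 (~~ s) ru rt) negbK.
have ru' : run [::] (u ++ [:: (Cap, size p)]) = Some (p ++ r).
  by rewrite run_cat ru /= run_cons step_cap.
have := @nu_R1_cup (~~ x) s m.+1 _ v _ _ ru'; rewrite -!catA /= addNb addbN negbK => ->//.
rewrite /is_link run_cat ru /= run_cons step_cap /= run_cons step_cup /=.
by move: rv; case: (odd m); rewrite ?addbF ?addbT ?negbK => ->.
Qed.

Lemma nu_R1_cap_link s m u i v :
    is_link (u ++ (Cap, i) :: v) ->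
  nu (u ++ twists i s m ++ (Cap, i) :: v) = nu (u ++ (Cap, i) :: v).
Proof.
rewrite {1}/is_link run_cat; case ru: (run [::] u) => [st|//] /=.
rewrite run_cons; case dst: (drop i st) => [|x [|y r]]; try by rewrite /step dst.
have sz : size (take i st) = i.
  by apply: size_takel; rewrite leqNgt; apply/negP=> lt; rewrite drop_oversize // ltnW in dst.
have [p st_p pi] : exists2 p, st = p ++ [:: x, y & r] & size p = i.
  by exists (take i st); rewrite // -dst cat_take_drop.
rewrite {dst sz}st_p -{}pi in ru *.
have [yx | xy] := eqVneq y (~~ x); last first.
  suff -> : step (Cap, size p) (p ++ [:: x, y & r]) = None by [].
  by rewrite /step drop_size_cat //; case: x y xy {ru} => [] [].
by rewrite yx in ru *; rewrite step_cap => /eqP; apply: nu_R1_cap ru.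
Qed.

(** A circle with one kink simplifies in two ways: at the cap the direction is kept, at the cup it
    is reversed. *)
Lemma nu_unknot b : nu [:: (Cup b, 0%N); (Cap, 0%N)] = 1.
Proof.
have T : nu [:: (Cup true, 0%N); (Cap, 0%N)] = 1.
  by rewrite (conway_unknot nablaP) /poly_mod2 rmorph1.
case: b => //; rewrite -T.
rewrite -(@nu_R1_cap true 1 [:: (Cup true, 0%N)] [::] [::] true [::]) //.
exact/esym/(@nu_R1_cup true true 1 [::] [:: (Cap, 0%N)] [::] [::]).
Qed.

(** * Twist regions applied to crossingless tangles *)

Lemma nu_tangle_R1 q b c s m v :
    is_link (tangle q b (c (+) odd m) ++ v) ->
  nu (tangle q b c ++ twists q s m ++ v) = nu (tangle q b (c (+) odd m) ++ v).
Proof.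
case: q => link.
  exact: (@nu_R1_cup c s m [:: (Cup b, 0%N)] v [:: b] [:: ~~ b]).
exact: (@nu_R1_cup c s m [:: (Cup b, 0%N)] v [::] [:: b; ~~ b]).
Qed.

(** A single crossing is both a horizontal and a vertical twist, of opposite handedness. *)
Lemma nu_tangle_slide q b c s v :
    is_link (tangle q b c ++ (Cross (~~ s), ~~ q : nat) :: v) ->
  nu (tangle (~~ q) b c ++ (Cross s, q : nat) :: v)
  = nu (tangle q b c ++ (Cross (~~ s), ~~ q : nat) :: v).
Proof.
case: q => /= link.
  exact: (@nu_local [:: (Cup b, 0%N)] _ _ v _ (Move_slide_cup c s 0)).
have := @nu_local [:: (Cup b, 0%N)] _ _ v _ (Move_slide_cup c (~~ s) 0).
by rewrite negbK => /(_ [:: b; ~~ b] erefl erefl) <- //.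
Qed.

Lemma nu_alt_snake q b v :
    is_link ((Cup b, 0%N) :: v) ->
  nu (alt (~~ q) b ++ (Cap, q : nat) :: v) = nu ((Cup b, 0%N) :: v).
Proof.
have ru : run [::] [:: (Cup b, 0%N)] = Some [:: b; ~~ b] by [].
case: q; rewrite /alt addNb; case: b ru => ru link.
- exact: (@nu_local [:: (Cup true, 0%N)] _ _ v _ (Move_snake_l true 0) ru).
- exact: (@nu_local [:: (Cup false, 0%N)] _ _ v _ (Move_snake_l false 0) ru).
- exact: (@nu_local [:: (Cup true, 0%N)] _ _ v _ (Move_snake_r false 0) ru).
- exact: (@nu_local [:: (Cup false, 0%N)] _ _ v _ (Move_snake_r true 0) ru).
Qed.

(** The cap from the smoothing straightens [alt (~~ q) b] to a single cup, and the new cup completes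
    the other tangle. *)
Lemma nu_alt_tw2 q b s m v :
    is_link (tangle q b (q (+) b (+) odd m) ++ v) ->
  nu (alt (~~ q) b ++ twists q s m.+2 ++ v)
  = nu (alt (~~ q) b ++ twists q s m ++ v)
    + 'X * nu (tangle q b (q (+) b (+) odd m) ++ v).
Proof.
move=> link.
have -> : nu (alt (~~ q) b ++ twists q s m.+2 ++ v)
  = nu (alt (~~ q) b ++ twists q s m ++ v)
    + 'X * nu (alt (~~ q) b ++ [:: (Cap, q : nat), (Cup (q (+) b (+) odd m), q : nat) & v]).
  case: q link => link.
    apply: (@nu_tw_antiparallel s m (alt false b) v [:: b] (~~ b) [:: ~~ b]).
      by rewrite run_alt negbK.
    move: link; rewrite /is_link run_cat run_tangle /= negbK.
    by case: b; case: (odd m) => /= /eqP.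
  apply: (@nu_tw_antiparallel s m (alt true b) v [::] b [:: b; ~~ b]).
    by rewrite run_alt.
  move: link; rewrite /is_link run_cat run_tangle /=.
  by case: b; case: (odd m) => /= /eqP.
by rewrite nu_alt_snake.
Qed.

Lemma nu_alt_tw q b s k (e : bool) v :
    is_link (tangle q b (q (+) b (+) e) ++ v) ->
  nu (alt (~~ q) b ++ twists q s (e + k.*2) ++ v)
  = nu (alt (~~ q) b ++ twists q s e ++ v)
    + k%:R * 'X * nu (tangle q b (q (+) b (+) e) ++ v).
Proof.
move=> link; elim: k => [|k IH]; first by rewrite addn0 !mul0r addr0.
rewrite doubleS !addnS nu_alt_tw2 oddD odd_double oddb addbF // IH; ring.
Qed.

(** The parallel skein relation is the Fibonacci recurrence in the number of crossings, started from
    zero and one crossing. *)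
Lemma nu_par_tw q b s m v :
    is_link (par q b ++ v) ->
  nu (par q b ++ twists (~~ q) s m.+1 ++ v)
  = fib2 m.+1 * nu (par q b ++ (Cross s, ~~ q : nat) :: v)
    + fib2 m * nu (par q b ++ v).
Proof.
move=> link.
have skein k : nu (par q b ++ twists (~~ q) s k.+2 ++ v)
    = nu (par q b ++ twists (~~ q) s k ++ v)
      + 'X * nu (par q b ++ twists (~~ q) s k.+1 ++ v).
  case: q link => link.
    apply: (@nu_tw_parallel s k (par true b) v [::] b [:: ~~ b; ~~ b]).
      by rewrite run_par.
    by move: link; rewrite /is_link run_cat run_par => /eqP.
  apply: (@nu_tw_parallel s k (par false b) v [:: ~~ b] b [:: ~~ b]).
    by rewrite run_par.
  by move: link; rewrite /is_link run_cat run_par => /eqP.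
elim/ltn_ind: m => -[_|[_|m IH]].
- by rewrite fib2_0 fib2_1 mul1r mul0r addr0.
- by rewrite skein fib2_SS fib2_1 fib2_0 mulr1 addr0 mul1r addrC.
by rewrite skein !IH // (fib2_SS m.+1) !(fib2_SS m); ring.
Qed.

Lemma nu_alt_tw_even q b s k v :
    is_link (alt q b ++ v) ->
  nu (alt (~~ q) b ++ twists q s k.*2 ++ v)
  = nu (alt (~~ q) b ++ v) + k%:R * 'X * nu (alt q b ++ v).
Proof.
by move=> link; have := @nu_alt_tw q b s k false v; rewrite addbF => ->.
Qed.

Lemma nu_alt_slide q b s v :
    is_link (par q b ++ v) ->
  nu (alt (~~ q) b ++ (Cross s, q : nat) :: v)
  = nu (par q b ++ (Cross (~~ s), ~~ q : nat) :: v).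
Proof.
move=> link; rewrite /alt addNb; apply: nu_tangle_slide.
rewrite -cat_rcons (link_prefix (u' := par q b)) // -cats1.
exact: (run_par_tw q b _ 1).
Qed.

Lemma nu_alt_tw_odd q b s k v :
    is_link (par q b ++ v) ->
  nu (alt (~~ q) b ++ twists q s k.*2.+1 ++ v)
  = nu (par q b ++ (Cross (~~ s), ~~ q : nat) :: v)
    + k%:R * 'X * nu (par q b ++ v).
Proof.
move=> link; rewrite -nu_alt_slide //.
by have := @nu_alt_tw q b s k true v; rewrite addbT => ->.
Qed.

Lemma nu_par_then_alt q b s n v :
    odd n -> is_link (alt q b ++ v) ->
  nu (par q b ++ twists q s n ++ v) = nu (alt q b ++ v).
Proof. by move=> n_odd link; rewrite nu_tangle_R1 n_odd addbT negbK. Qed.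

Lemma nu_alt_then_par q b s n v :
    odd n -> is_link (par q b ++ v) ->
  nu (alt q b ++ twists q s n ++ v) = nu (par q b ++ v).
Proof. by move=> n_odd link; rewrite nu_tangle_R1 n_odd addbT. Qed.

(** Slid back to position [q], the lone crossing joins the 2k+1 others and makes k+1 antiparallel
    pairs. *)
Lemma nu_crossed_then_alt q b s k v :
    is_link (alt q b ++ v) ->
  nu (par q b ++ (Cross (~~ s), ~~ q : nat) :: twists q s k.*2.+1 ++ v)
  = nu (alt (~~ q) b ++ v) + k.+1%:R * 'X * nu (alt q b ++ v).
Proof.
move=> link; rewrite -(@nu_alt_tw_even q b s k.+1 v link) -nu_alt_slide //.
by rewrite catA (link_prefix _ (@run_par_tw_same q q b s _ _)) //= odd_double.
Qed.

(** * Three consecutive regions *)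

Lemma nu_triple_par q b k v :
    is_link (alt q b ++ v) ->
  let n := k.*2.+1 in
  nu (par q b ++ twists (~~ q) (~~ q) n ++ twists q q n ++ v)
  = fib2 n * (nu (alt (~~ q) b ++ v) + k.+1%:R * 'X * nu (alt q b ++ v))
    + fib2 k.*2 * nu (alt q b ++ v).
Proof.
move=> link n; have n_odd : odd n by rewrite /= odd_double.
rewrite nu_par_tw; last by rewrite catA (link_prefix _ (@run_par_tw_same q q b q _ _)).
by rewrite nu_crossed_then_alt // nu_par_then_alt.
Qed.

Lemma nu_triple_alt_same q b k v :
    is_link (alt q b ++ v) ->
  let n := k.*2.+1 in
  nu (alt q b ++ twists q q n ++ twists (~~ q) (~~ q) n ++ twists q q n ++ v)
  = fib2 n * (nu (alt (~~ q) b ++ v) + k.+1%:R * 'X * nu (alt q b ++ v))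
    + fib2 k.*2 * nu (alt q b ++ v).
Proof.
move=> link n; have n_odd : odd n by rewrite /= odd_double.
rewrite nu_alt_then_par ?nu_triple_par //.
rewrite catA (link_prefix _ (run_par_tw q b _ _)) catA.
by rewrite (link_prefix _ (@run_par_tw_same q q b q _ _)).
Qed.

(** The first region leaves two terms: one crossing, which slides into the middle region and makes
    n+1 crossings there, and kz times [par q b], handled by [nu_triple_par]. *)
Lemma nu_triple_alt_other q b k v :
    is_link (alt q b ++ v) ->
  let n := k.*2.+1 in
  let x := nu (alt (~~ q) b ++ v) + k.+1%:R * 'X * nu (alt q b ++ v) in
  let y := nu (alt q b ++ v) in
  nu (alt (~~ q) b ++ twists q q n ++ twists (~~ q) (~~ q) n ++ twists q q n ++ v)
  = fib2 n.+1 * x + fib2 n * y + k%:R * 'X * (fib2 n * x + fib2 k.*2 * y).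
Proof.
move=> link n x y; have n_odd : odd n by rewrite /= odd_double.
have link' : is_link (par q b ++ twists q q n ++ v).
  by rewrite catA (link_prefix _ (@run_par_tw_same q q b q _ _)).
rewrite nu_alt_tw_odd; last by rewrite catA (link_prefix _ (run_par_tw q b _ _)).
rewrite -cat_cons -twistsS nu_par_tw // nu_crossed_then_alt //.
by rewrite nu_par_then_alt ?nu_triple_par.
Qed.

Lemma nu_closing_alt_unknot q b : nu (alt (~~ q) b ++ closing q) = 1.
Proof.
rewrite -(nu_unknot b); apply: (@nu_alt_snake q b [:: (Cap, 0%N)]).
by case: b.
Qed.

(* The two diagrams of a crossing change in a kinked unknot are unknots, and the
   smoothing is this unlink. *)
Lemma nu_closing_alt_unlink q b : nu (alt q b ++ closing q) = 0.
Proof.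
have := @nu_alt_tw_even q b true 1 (closing q) (link_alt_closing _ _ _).
rewrite nu_R1_cap_link ?link_alt_closing // mul1r -[LHS]addr0 => /addrI /esym /eqP.
by rewrite mulf_eq0 polyX_eq0 => /eqP.
Qed.

(* The next region, at position [q], twists [alt (~~ q) b] and only adds kinks to
   [alt q b]; the two exchange roles after three regions since [q] changes, and
   once more, through [e], if [n = 3 %[mod 4]]. *)
Lemma nu_triples k r q b v :
    is_link (alt q b ++ v) ->
  let n := k.*2.+1 in
  let e := odd k in
  let N := (r * (k + ~~ e).*2)%N in
  let q' := q (+) odd r in
  let x := nu (alt (~~ q' (+) e) b ++ v) in
  let y := nu (alt (q' (+) e) b ++ v) in
  nu (alt (~~ q (+) e) b ++ blocks q n (3 * r) ++ v)
    = fib2 N.+1 * x + fib2 N * y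
  /\ nu (alt (q (+) e) b ++ blocks q n (3 * r) ++ v)
    = fib2 N * x + (fib2 N.+1 + 'X * fib2 N) * y.
Proof.
move=> link n e; elim: r q link => [|r IH] q link.
  by rewrite /= !addbF fib2_1 fib2_0; split; ring.
have n_odd : odd n by rewrite /= odd_double.
set w := blocks (~~ q) n (3 * r) ++ v.
have -> : blocks q n (3 * r.+1) ++ v
    = twists q q n ++ twists (~~ q) (~~ q) n ++ twists q q n ++ w.
  by rewrite /w mulnS blocks_triple -!catA.
have link_w : is_link (alt q b ++ w).
  rewrite /w catA (link_prefix _ (u' := alt q b)) //.
  by rewrite run_cat run_alt /= run_triples // if_same.
have link' : is_link (alt (~~ q) b ++ v) by rewrite (link_alt _ q).
move=> N q' x y; set p := (k + ~~ e).*2 in IH N *; set N' := (r * p)%N in IH.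
have [] := IH _ link'.
rewrite -/w negbK (_ : ~~ q (+) odd r = q') -/x -/y; last by rewrite addNb -addbN.
have NE : N = (N' + p)%N by rewrite addnC.
move=> e1 e2.
(* The addition formulas split off the last [r] triples; what remains is that one triple acts by the
   [p]-th power. *)
have -> : fib2 N.+1 * x + fib2 N * y = fib2 p.+1 * nu (alt (q (+) e) b ++ w)
                                       + fib2 p * nu (alt (~~ q (+) e) b ++ w).
  by rewrite e1 e2 NE fib2_addS fib2_add; ring.
have -> : fib2 N * x + (fib2 N.+1 + 'X * fib2 N) * y
    = fib2 p * nu (alt (q (+) e) b ++ w)
      + (fib2 p.+1 + 'X * fib2 p) * nu (alt (~~ q (+) e) b ++ w).
  by rewrite e1 e2 NE fib2_addS fib2_add; ring.
have := @nu_triple_alt_other q b k w link_w.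
have := @nu_triple_alt_same q b k w link_w.
(* Exactly one of the coefficients k and k+1 survives modulo 2. *)
cbv zeta; rewrite -/n !(natr_poly2 k) (natr_poly2 k.+1) oddS /p /e.
case: (odd k) => eA eB; rewrite ?addbT ?addbF ?negbK {}eA {}eB ?addn0 ?addn1 ?doubleS /=.
  split; first by ring.
  apply: (eq_poly2 (t := 'X * fib2 k.*2.+1 * nu (alt (~~ q) b ++ w))).
  by rewrite /n !fib2_SS; ring.
split; first by rewrite /n !fib2_SS; ring.
apply: (eq_poly2 (t := - 'X * fib2 k.*2.+2 * nu (alt (~~ q) b ++ w))).
by rewrite /n !fib2_SS; ring.
Qed.

(** * The knots: j = 0 or 1 modulo 3 *)

Lemma nu_cups b1 b2 v : is_link (tangle false b2 b1 ++ v) ->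
  nu ([:: (Cup b1, 0%N); (Cup b2, 2)] ++ v) = nu (tangle false b2 b1 ++ v).
Proof.
exact: (@nu_local [::] _ _ v _ (Move_far (Cup b1) (Cup b2) 0 0)).
Qed.

Lemma nu_closing_alt p q b : nu (alt p b ++ closing q) = (p (+) q)%:R.
Proof.
have [-> | /negPf pq] := eqVneq p q; first by rewrite nu_closing_alt_unlink addbb.
by rewrite (_ : p = ~~ q) ?nu_closing_alt_unknot ?addNb ?addbb //; case: p q pq => [] [].
Qed.

Lemma nu_conway_3r k r b1 b2 :
  let n := k.*2.+1 in
  let N := (r * (k + ~~ odd k).*2)%N in
  is_link (conway_diagram b1 b2 (nseq (3 * r) n%:Z)) ->
  nu (conway_diagram b1 b2 (nseq (3 * r) n%:Z))
  = if odd k then fib2 N.+1 + 'X * fib2 N else fib2 N.+1.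
Proof.
move=> n N; have n_odd : odd n by rewrite /= odd_double.
rewrite conway_diagram_nseq oddM /= => link.
have b12 : b1 = b2.
  move: link; rewrite link_cups run_cat run_triples //.
  by case: (odd r) b1 b2 => [] [] [].
have link_alt : is_link (alt true b2 ++ closing (~~ odd r)) by exact: link_alt_closing.
rewrite nu_cups ?link_tangle_cups // b12.
have [] := @nu_triples k r true b2 _ link_alt.
rewrite -/n -/N -/(alt false b2) addTb; case: (odd k).
  by rewrite !nu_closing_alt => _ ->; case: (odd r) => /=; ring.
by rewrite !nu_closing_alt => -> _; case: (odd r) => /=; ring.
Qed.

(** The closure forces [b1 = ~~ b2], so the first region twists parallel strands: it is the middle
    of a triple, as is the last one. *)
Lemma nu_conway_3r1 k r b1 b2 :
  let n := k.*2.+1 in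
  let N := (r.+1 * (k + ~~ odd k).*2)%N in
  is_link (conway_diagram b1 b2 (nseq (3 * r).+1 n%:Z)) ->
  nu (conway_diagram b1 b2 (nseq (3 * r).+1 n%:Z))
  = if odd k then fib2 N.+1 else fib2 N.+1 + 'X * fib2 N.
Proof.
move=> n N; have n_odd : odd n by rewrite /= odd_double.
have oddj : ~~ odd (3 * r).+1 = odd r by rewrite /= oddM negbK.
rewrite conway_diagram_nseq oddj => link.
have blocksS : blocks true n (3 * r).+1
    = blocks true n (3 * r) ++ twists (~~ odd r) (~~ odd r) n.
  by rewrite -addn1 blocksD oddM addTb /= cats0.
have b12 : b1 = ~~ b2.
  move: link; rewrite link_cups run_cat blocksS run_cat run_triples //=.
  by case: (odd r); rewrite ?run_tw0 ?run_tw1 //=; case: b1 b2 => [] [].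
have link_alt : is_link (alt false b2 ++ closing (odd r)) by exact: link_alt_closing.
rewrite nu_cups ?link_tangle_cups // b12.
have link' : is_link (par false b2 ++ blocks true n (3 * r).+1 ++ closing (odd r)).
  by move: link; rewrite -link_tangle_cups b12.
(* Kinks on the first cup and on the last cap complete the triples at both ends. *)
rewrite -[tangle false b2 (~~ b2)]/(par false b2).
have -> : nu (par false b2 ++ blocks true n (3 * r).+1 ++ closing (odd r))
    = nu (alt false b2 ++ blocks false n (3 * r.+1) ++ closing (odd r)).
  have -> : blocks false n (3 * r.+1) = twists false false n ++ blocks true n (3 * r).+1
                                      ++ twists (odd r) (odd r) n.
    rewrite mulnS (_ : 3 + 3 * r = 1 + ((3 * r).+1 + 1))%N; last by rewrite addn1.
    by rewrite !blocksD -[odd (3 * r).+1]negbK oddj addTb negbK /= !cats0.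
  rewrite -[LHS](@nu_alt_then_par _ _ false n) //.
  move: (blocks true n (3 * r).+1) link' => w link'.
  set u := alt false b2 ++ twists false false n ++ w.
  have := @nu_R1_cap_link (odd r) n u (odd r) [:: (Cap, 0%N)].
  rewrite /u -!catA => -> //.
  rewrite catA (link_prefix _ (run_alt_tw _ _ _ _ _)) n_odd; exact: link'.
have [] := @nu_triples k r.+1 false b2 _ link_alt.
rewrite -/n -/N; case: (odd k).
  by rewrite !nu_closing_alt => -> _; rewrite oddS; case: (odd r) => /=; ring.
by rewrite !nu_closing_alt => _ ->; rewrite oddS; case: (odd r) => /=; ring.
Qed.

(** * The two-component links: j = 2 modulo 3 *)

Lemma nu_alt_tw_same q b s k v :
    is_link (alt q b ++ v) -> nu (alt q b ++ twists q s k.*2 ++ v) = nu (alt q b ++ v).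
Proof. by move=> link; rewrite nu_tangle_R1 odd_double addbF. Qed.

(** A region adds a multiple of z times one value to the other; the next region has the other
    position, which exchanges the two and gives the matrix of [continuant_step]. *)
Lemma nu_even_regions k b l v :
    is_link (alt true b ++ v) ->
  let q := ~~ odd k in
  let w := twist_regions k (doubled l) ++ v in
  let q' := q (+) odd (size l) in
  (nu (alt (~~ q) b ++ w), nu (alt q b ++ w))
  = foldr continuant_step (nu (alt (~~ q') b ++ v), nu (alt q' b ++ v)) l.
Proof.
move=> link; elim: l k => [|x l IH] k; first by rewrite /= addbF.
cbv zeta; have link_w : is_link (alt (~~ odd k) b ++ twist_regions k.+1 (doubled l) ++ v).
  by rewrite catA (link_prefix _ (run_alt_doubled _ true _ _ _)).
rewrite [twist_regions _ _]/= -/(doubled l) twist_region_doubled -catA.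
rewrite nu_alt_tw_even // nu_alt_tw_same // [foldr _ _ _]/=.
have := IH k.+1; cbv zeta.
have -> : ~~ odd k.+1 (+) odd (size l) = ~~ odd k (+) odd (size (x :: l)).
  by rewrite /= addbN addNb.
rewrite oddS negbK => <-.
by rewrite /continuant_step natr_poly2 /=; congr pair; ring.
Qed.

Lemma nu_conway_doubled b1 b2 l :
  l != [::] -> all (fun x => x != 0) l ->
  let D := conway_diagram b1 b2 (doubled l) in
  is_link D -> antiparallel D -> nu D = (foldr continuant_step (1, 0) l).1.
Proof.
move=> l_neq0 l_nz D link anti.
(* The first region is not empty, and its first crossing, of strands 1 and 2, is antiparallel only
   in this case. *)
have b12 : b1 = b2.
  case: l l_neq0 l_nz @D link anti => // x l _ /andP[x_neq0 _] D _.
  rewrite /D /conway_diagram [twist_regions _ _]/= twist_region_doubled.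
  have -> : `|x|.*2 = (`|x|.*2.-1).+1 by lia.
  by case: b1 {D} b2 => [] [].
have D_eq : D = [:: (Cup b1, 0%N); (Cup b2, 2)] ++
    twist_regions 0 (doubled l) ++ closing (~~ odd (size l)).
  by rewrite /D /conway_diagram /closing size_map; case: (odd _).
rewrite D_eq in link *; rewrite nu_cups ?link_tangle_cups // b12.
have := @nu_even_regions 0 b2 l _ (link_alt_closing true (~~ odd (size l)) b2).
cbv zeta; rewrite !nu_closing_alt // !addTb addbb addNb addbb => <-.
by [].
Qed.

(** Whatever expansion orients [D], uniqueness identifies it with [even_exp k r], whose continuant
    is known. *)
Lemma nu_fibonacci_3r2 k r D :
    even_orientation (nseq (3 * r + 2) k.*2.+1%:Z) D ->
  nu D = fib2 (r.+1 * (k + ~~ odd k).*2)%N.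
Proof.
case=> l [l_nz l_eq [D' [[link' [b1 [b2 D'E]]] anti iso]]].
rewrite (conway_isotopy nablaP iso) D'E.
have [_ E_eq] := cfrac_even_exp k r.
have lE : l = even_exp k r.
  by apply: doubled_cfrac_inj (even_exp_neq0 k r) _; rewrite // E_eq.
rewrite D'E in link' anti.
rewrite nu_conway_doubled // ?lE ?continuant_even_exp //.
by case: r {E_eq lE l_eq}.
Qed.

End Skein.

(** * The three residues of j and the index N *)

Lemma mod3_split j : exists r, j = (3 * r)%N \/ j = (3 * r).+1 \/ j = (3 * r + 2)%N.
Proof. by exists (j %/ 3)%N; lia. Qed.

Lemma fib2_predP N : (0 < N)%N -> fib2 N.+1 + 'X * fib2 N = fib2 N.-1.
Proof. by case: N => // m _; rewrite -fib2_pred. Qed.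

Theorem theorem13 (n j : nat) (n_odd : odd n) (j_gt0 : (0 < j)%N)
    (nabla : diagram -> {poly int}) (nablaP : is_conway_polynomial nabla)
    (D : diagram) (DP : fibonacci_link n j D) :
  (n = 1 %[mod 4] ->
     exists2 N : nat,
       N%:Z = ((j + 2) %/ 3)%N%:Z * (n%:Z - 2) + j%:Z + 1
       & poly_mod2 (nabla D) = poly_mod2 (fib_poly N))
  /\
  (n = 3 %[mod 4] ->
     exists2 N : nat,
       N%:Z = ((j + 2) %/ 3)%N%:Z * (n%:Z + 2) - (j%:Z + 1)
       & poly_mod2 (nabla D) = poly_mod2 (fib_poly N)).
Proof.
have [k nE] : exists k, n = k.*2.+1.
  by exists n./2; rewrite -[LHS]odd_double_half n_odd.
have [[link [b1 [b2 DE]]] orient] := DP.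
have [r [jE | [jE | jE]]] := mod3_split j.
- have qE : ((j + 2) %/ 3 = r)%N by lia.
  have := @nu_conway_3r _ nablaP k r b1 b2.
  cbv zeta; rewrite -nE -jE -DE => /(_ link) ->.
  split=> n_mod.
    (* As n = 2k + 1, the residue of n modulo 4 is the parity of [k]. *)
    have k_even : ~~ odd k by lia.
    exists (r * (k + 1).*2).+1; last by rewrite (negPf k_even).
    rewrite qE jE nE; nia.
  have k_odd : odd k by lia.
  (* [r] is positive because [j] is, and [k] because it is odd; so the index has a predecessor. *)
  have N_gt0 : (0 < r * k.*2)%N by nia.
  exists (r * k.*2).-1; last by rewrite k_odd addn0 fib2_predP.
  rewrite qE jE nE; nia.
- have qE : ((j + 2) %/ 3 = r.+1)%N by lia.
  have := @nu_conway_3r1 _ nablaP k r b1 b2.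
  cbv zeta; rewrite -nE -jE -DE => /(_ link) ->.
  split=> n_mod.
    have k_even : ~~ odd k by lia.
    exists (r.+1 * (k + 1).*2).-1; last by rewrite (negPf k_even) fib2_predP //; lia.
    rewrite qE jE nE; nia.
  have k_odd : odd k by lia.
  exists (r.+1 * k.*2).+1; last by rewrite k_odd addn0.
  rewrite qE jE nE; nia.
have qE : ((j + 2) %/ 3 = r.+1)%N by lia.
have := @nu_fibonacci_3r2 _ nablaP k r D.
rewrite -nE -jE => -> ; last by apply: orient; lia.
split=> n_mod.
  have k_even : ~~ odd k by lia.
  exists (r.+1 * (k + 1).*2)%N; last by rewrite (negPf k_even).
  rewrite qE jE nE; nia.
have k_odd : odd k by lia.
exists (r.+1 * k.*2)%N; last by rewrite k_odd addn0.
rewrite qE jE nE; nia.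
Qed.
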